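(* Let $F:[1,\infty)\to\mathbb{R}$ be a non-decreasing, right-continuous function with $F(1)=0$, $F(x)\to\infty$ as $x\to\infty$, and satisfying the Chebyshev upper bound $F(x)\ll x/\log x$ (for large $x$). Then there exists a set of generalized primes $\mathcal{P}=\{p_j\}_{j}$ such that $|\pi_{\mathcal{P}}(x)-F(x)|\le 2$ for all $x\ge 1$, and such that for all real $t$ and all $x\ge 1$ \[ \Bigl|\sum_{p_j\le x}p_j^{-\mathrm{i}t}-\int_1^x u^{-\mathrm{i}t}\,\mathrm{d}F(u)\Bigr|\ll \sqrt{x}+\sqrt{\frac{x\log(|t|+1)}{\log(x+1)}}, \] where the implied constant is independent of $x$ and $t$. If in addition $F$ is continuous, then $\mathcal{P}$ can be chosen to be strictly increasing and such that $|\pi_{\mathcal{P}}(x)-F(x)|\le 1$ for all $x\ge1$. *)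

(* Defs.v *)
From HB Require Import structures.
From mathcomp Require Import all_boot all_order all_algebra.
From mathcomp Require Import all_classical all_reals all_analysis.
Set Implicit Arguments. Unset Strict Implicit. Unset Printing Implicit Defensive.
Import Order.TTheory GRing.Theory Num.Theory.
Import numFieldNormedType.Exports.
Local Open Scope classical_set_scope.
Local Open Scope ring_scope.

Definition gen_primes (R : realType) (p : nat -> R) : Prop :=
  1 < p 0%N /\ (forall i j : nat, (i <= j)%N -> p i <= p j) /\ p @ \oo --> +oo.

(* pi_P(x) = #{ j : p_j <= x } (a finite set for generalized primes). *)
Definition gpi (R : realType) (p : nat -> R) (x : R) : R :=
  \sum_(j \in [set j : nat | p j <= x]) (1 : R).

(* real and imaginary parts of sum_{p_j <= x} p_j^{-it}
   (p_j^{-it} = cos (t log p_j) - i sin (t log p_j)). *)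
Definition gsum_re (R : realType) (p : nat -> R) (t x : R) : R :=
  \sum_(j \in [set j : nat | p j <= x]) cos (t * ln (p j)).
Definition gsum_im (R : realType) (p : nat -> R) (t x : R) : R :=
  \sum_(j \in [set j : nat | p j <= x]) (- sin (t * ln (p j))).

(* Stieltjes integral int_1^x g(u) dF(u), as the Lebesgue-Stieltjes integral
   over ]1, x] (F vanishes on (-oo,1], so there is no mass at or below 1). *)
Definition stieltjes (R : realType) (F : cumulative R R) (g : R -> R) (x : R) : R :=
  Rintegral (lebesgue_stieltjes_measure F) `]1, x] g.

Definition sint_re (R : realType) (F : cumulative R R) (t x : R) : R :=
  stieltjes F (fun u => cos (t * ln u)) x.
Definition sint_im (R : realType) (F : cumulative R R) (t x : R) : R :=
  stieltjes F (fun u => - sin (t * ln u)) x.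

Definition osc_err (R : realType) (F : cumulative R R) (p : nat -> R) (t x : R) : R :=
  Num.sqrt ((gsum_re p t x - sint_re F t x) ^+ 2 + (gsum_im p t x - sint_im F t x) ^+ 2).

Definition osc_bound (R : realType) (F : cumulative R R) (p : nat -> R) : Prop :=
  exists C : R, forall t x : R, 1 <= x ->
    osc_err F p t x <= C * (Num.sqrt x + Num.sqrt (x * ln (`|t| + 1) / ln (x + 1))).

(* Main.v *)
Require Import Defs.
From HB Require Import structures.
From mathcomp Require Import all_boot all_order all_algebra.
From mathcomp Require Import all_classical all_reals all_analysis.
From mathcomp Require Import measurable_realfun zify ring lra.
Import Order.TTheory GRing.Theory Num.Theory.
Import numFieldNormedType.Exports.
Local Open Scope classical_set_scope.
Local Open Scope ring_scope.

(** Let Q be the quantile function of F, so that dF is the image of Lebesgue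
    measure on ]0, +oo[ under Q and Q y <= x iff y <= F x.  Take p_j = Q (y_j)
    with y_j in ]j, j+1].  Whatever the choice of the y_j, the number of p_j <= x
    differs from F x by at most 1.  For the exponential sums, choosing each y_j
    uniformly at random would give Hoeffding deviations sqrt (n log (L + 2)) for
    n terms and polynomially many (in L) test functions; the random choice is
    replaced by the method of conditional expectations: a weighted sum of all
    the exponential moments has conditional mean no larger than its current
    value, so y_j can be chosen so that it grows by at most 1 at each step.  The
    test functions are u^(-it) for t in a grid of mesh 1/(L+1), with L about
    x + |t|, and F x << x / log x turns the deviation into the stated bound. *)

(** * Quantile function and the image of Lebesgue measure *)

(** Generalized inverse of [F]. The condition [1 <= x] bounds the set below, also for [y <= 0], so
    [inf] is a genuine infimum. *)
Definition quantile (R : realType) (F : R -> R) (y : R) : R :=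
  inf [set x | 1 <= x /\ y <= F x].
Arguments quantile {R} F y.

Section Quantile.
Context (R : realType) (F : cumulative R R).
Hypotheses (F0 : forall x : R, x <= 1 -> F x = 0)
           (Finfty : F x @[x --> +oo] --> +oo).

Lemma cumulative_homo : {homo F : x y / x <= y}.
Proof. exact: cumulative_is_nondecreasing. Qed.

Lemma quantile_set_nonempty (y : R) : [set x | 1 <= x /\ y <= F x] !=set0.
Proof.
move/cvgryPge : Finfty => /(_ y) Fy.
have : \forall x \near +oo, 1 <= x /\ y <= F x.
  by near=> x; split; near: x => //; exact: nbhs_pinfty_ge.
by move=> /(@filter_ex R (pinfty_nbhs R) _ _) [x hx]; exists x.
Unshelve. all: by end_near. Qed.

Lemma quantile_ge1 (y : R) : 1 <= quantile F y.
Proof. by apply: lb_le_inf; [exact: quantile_set_nonempty|move=> x []]. Qed.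

(** Right-continuity makes the infimum attained: just to the right of the quantile [F] is already at
    least [y], and there it exceeds its value at the quantile by at most [e]. *)
Lemma le_cumulative_quantile (y : R) : y <= F (quantile F y).
Proof.
apply/ler_addgt0Pr => e e0.
have [d Fd] := nondecreasing_right_continuousP (quantile F y) F e0.
apply: le_trans Fd.
have : quantile F y < quantile F y + d%:num by rewrite ltrDl.
move/inf_lt => /(_ (quantile_set_nonempty y)) [x [_ yFx] xq].
by rewrite (le_trans yFx)// cumulative_homo// ltW.
Qed.

Lemma quantile_le (y x : R) : 1 <= x -> (quantile F y <= x) = (y <= F x).
Proof.
move=> x1; apply/idP/idP => [|yFx]; last by apply: ge_inf => //; exists 1 => z [].
by move/cumulative_homo; apply: le_trans; exact: le_cumulative_quantile.
Qed.

Lemma cumulative_ge0 (x : R) : 0 <= F x.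
Proof.
rewrite -(F0 (Num.min x 1)) ?ge_min ?lexx ?orbT//.
by apply: cumulative_homo; rewrite ge_min lexx.
Qed.

(** For [x < 1] both sides are false: quantiles are at least 1, while [F x = 0 < y]. *)
Lemma quantile_le_gt0 (y x : R) : 0 < y -> (quantile F y <= x) = (y <= F x).
Proof.
move=> y0; have [x1|x1] := leP 1 x; first exact: quantile_le.
rewrite (F0 _ (ltW x1)) [RHS]leNgt y0 leNgt.
by rewrite (lt_le_trans x1 (quantile_ge1 y)).
Qed.

Lemma quantile_gt1 (y : R) : 0 < y -> 1 < quantile F y.
Proof. by move=> y0; rewrite ltNge quantile_le// F0// -ltNge. Qed.

Lemma quantile_homo : {homo quantile F : x y / x <= y}.
Proof.
move=> x y xy; rewrite quantile_le ?quantile_ge1//.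
exact/(le_trans xy)/le_cumulative_quantile.
Qed.

Lemma measurable_quantile : measurable_fun [set: R] (quantile F).
Proof. by apply: nondecreasing_measurable => //; exact: quantile_homo. Qed.

Lemma quantile_cvgy (u : nat -> R) : (forall n, n%:R <= u n) ->
  (quantile F \o u) @ \oo --> +oo.
Proof.
move=> un; apply/cvgryPge => A.
near=> n; rewrite /= leNgt; apply/negP => qA.
have : 1 <= Num.max A 1 by rewrite le_max lexx orbT.
move=> /(quantile_le (u n)); rewrite le_max (ltW qA)/= => /esym.
apply/negP; rewrite -ltNge; apply: lt_le_trans (un n).
near: n; exact: nbhs_infty_gtr.
Unshelve. all: by end_near. Qed.

Lemma quantile_strict : {in `[1, +oo[, continuous F} ->
  forall x y : R, 0 < x -> x < y -> quantile F x < quantile F y.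
Proof.
move=> Fc x y x0 xy; rewrite lt_neqAle quantile_homo ?andbT//; last exact: ltW.
apply/eqP => qxy.
(* equal quantiles at x < y would make F jump over x *)
have q1 : 1 < quantile F x by exact: quantile_gt1.
have : F z @[z --> quantile F x] --> F (quantile F x).
  by apply: Fc; rewrite in_itv/= ltW.
move=> /cvgr_gt /(_ x).
have xF : x < F (quantile F x).
  by rewrite (lt_le_trans xy)// qxy le_cumulative_quantile.
move=> /(_ xF)/nbhs_ballP[e /= e0 He].
pose d := Num.min (e / 2) ((quantile F x - 1) / 2).
have d0 : 0 < d by rewrite lt_min !divr_gt0//= subr_gt0.
have /He : ball (quantile F x) e (quantile F x - d).
  rewrite /ball/= opprB addrC subrK gtr0_norm//.
  by rewrite /d gt_min ltr_pdivrMr// ltr_pMr// ltr1n.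
rewrite ltNge => /negP; apply.
have : quantile F x - d < quantile F x by rewrite ltrBlDr ltrDl.
rewrite ltNge => /negP/negP; rewrite -ltNge => qd.
have : ~~ (quantile F x <= quantile F x - d) by rewrite -ltNge.
by rewrite quantile_le_gt0// -ltNge => /ltW.
Qed.

Let mu := @lebesgue_measure R.

Lemma preimage_quantile_itv (a b : R) : 1 <= a ->
  quantile F @^-1` `]a, b]%classic = `]F a, F b]%classic.
Proof.
move=> a1; apply/seteqP; split => y /=; rewrite !in_itv/= !ltNge.
  by move=> /andP[ay yb]; rewrite -quantile_le// ay -quantile_le// (le_trans (quantile_ge1 y)).
move=> /andP[ay yb]; rewrite quantile_le// ay quantile_le//.
rewrite leNgt; apply/negP => b1; move: ay; rewrite -ltNge.
by rewrite ltNge => /negP; apply; rewrite (le_trans yb)// cumulative_homo// (le_trans (ltW b1)).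
Qed.

Let posR : set (measurableTypeR R) := `]0, +oo[%classic.
Let mposR : measurable posR. Proof. exact: measurable_itv. Qed.

Let mQ : measurable_fun [set: measurableTypeR R]
  (quantile F : measurableTypeR R -> measurableTypeR R).
Proof. exact: measurable_quantile. Qed.

(** Uniqueness of the Stieltjes measure reduces this to intervals []a, b]]. Lebesgue measure is
    restricted to []0, +oo[] because every [y <= 0] has quantile 1, which would put infinite mass at
    1. *)
Lemma stieltjes_quantile_set (A : set (measurableTypeR R)) : measurable A ->
  lebesgue_stieltjes_measure F A = pushforward (mrestr mu mposR)
    (quantile F : measurableTypeR R -> measurableTypeR R) A.
Proof.
apply: lebesgue_stieltjes_measure_unique => //.
move=> _ [[a b] _ <-] /=.
rewrite /lebesgue_stieltjes_measure /measure_extension.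
rewrite measurable_mu_extE/=; last exact: (is_ocitv a b).
rewrite wlength_itv /pushforward /mrestr.
have -> : quantile F @^-1` `]a, b]%classic `&` posR = `]F a, F b]%classic.
  apply/seteqP; rewrite /posR; split => y /=; rewrite !in_itv/= ?andbT.
    move=> [/andP[ay yb] y0]; apply/andP; split; last by rewrite -quantile_le_gt0//.
    by rewrite ltNge -quantile_le_gt0// -ltNge.
  move=> /andP[ay yb]; have y0 : 0 < y by exact: le_lt_trans (cumulative_ge0 a) ay.
  by split => //; rewrite quantile_le_gt0// yb andbT ltNge quantile_le_gt0// -ltNge.
(* The length is tested by [F a < F b], the weight by [a < b]. If the tests disagree, then
   [F a = F b] and both values are 0. *)
rewrite lebesgue_measure_itv/= !lte_fin; case: ifPn => [ab|]; case: ifPn => //.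
  rewrite -leNgt => Fba; have Fab := cumulative_homo _ _ (ltW ab).
  by rewrite (le_anti (introT andP (conj Fab Fba))) subee.
by move=> Fab /negP; case; rewrite ltNge; apply: contraTN Fab => /cumulative_homo; rewrite -leNgt.
Qed.

Lemma stieltjes_quantile (g : R -> R) (x : R) :
  measurable_fun [set: R] g -> (forall u, `|g u| <= 1) ->
  stieltjes F g x = \int[mu]_(y in `]0, F x]) g (quantile F y).
Proof.
move=> mg g1; rewrite /stieltjes /Rintegral; congr fine.
have mEg : measurable_fun [set: measurableTypeR R] (EFin \o g).
  exact/measurable_EFinP.
rewrite [LHS](eq_measure_integral (pushforward (mrestr mu mposR)
    (quantile F : measurableTypeR R -> measurableTypeR R))); last first.
   by move=> A mA _; exact: stieltjes_quantile_set.
rewrite (integral_pushforward mQ mEg); last exact: measurable_itv.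
  rewrite preimage_quantile_itv// F0//.
  apply: eq_measure_integral => A mA AF; rewrite /mrestr; congr (mu _).
  by rewrite /posR; apply/setIidPl => y /AF /=; rewrite !in_itv/= andbT => /andP[].
rewrite preimage_quantile_itv// F0//.
apply: measurable_bounded_integrable; first exact: measurable_itv.
- rewrite /mrestr (le_lt_trans (y := mu `]0, F x]%classic))//.
    apply: le_measure; rewrite ?inE; last exact: subIsetl.
      by apply: measurableI; exact: measurable_itv.
    exact: measurable_itv.
  by rewrite /mu lebesgue_measure_itv/=; case: ifP => _; rewrite ltry.
- by apply: measurable_funTS; exact: measurableT_comp.
- by exists 1; split => // M M1 y _ /=; rewrite (le_trans (g1 _))// ltW.
Qed.

End Quantile.

(** * Exponential moments and selection of a good point *)

(** The linear term integrates to zero for a centred function, which leaves a subgaussian bound. If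
    [x >= 1/2] then [x <= 2 * x ^+ 2]; otherwise compare with [(1 - x)^-1]. *)
Lemma expR_le_quadratic (R : realType) (x : R) : expR x <= x + expR (2 * x ^+ 2).
Proof.
have [x2|x2] := leP (1 / 2) x.
  rewrite -[leLHS]add0r lerD//; first lra.
  by rewrite ler_expR; nra.
have e1 : expR x <= (1 - x)^-1.
  rewrite -[x in leLHS]opprK expRN lef_pV2 ?posrE ?expR_gt0//; last lra.
  exact: expR_ge1Dx.
have e2 : (1 - x)^-1 <= 1 + x + 2 * x ^+ 2.
  rewrite -[leLHS]mul1r ler_pdivrMr; last lra.
  have -> : (1 + x + 2 * x ^+ 2) * (1 - x) = 1 + x ^+ 2 * (1 - 2 * x) by ring.
  by rewrite lerDl mulr_ge0 ?sqr_ge0//; lra.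
rewrite (le_trans e1)// (le_trans e2)// addrAC addrC lerD2l.
exact: expR_ge1Dx.
Qed.

Section Derandomization.
Context d (T : measurableType d) (R : realType) (mu : {measure set T -> \bar R}).

(* The slack 1 avoids having to show that a function cannot exceed its mean
   everywhere. *)
Lemma le_series_of_le_integral (D : set T) (H : nat -> T -> R) (h : nat -> R) (B : R) :
  measurable D -> mu D = 1%E ->
  (forall n, measurable_fun D (H n)) -> (forall n x, D x -> 0 <= H n x) ->
  (forall n, (\int[mu]_(x in D) (H n x)%:E <= (h n)%:E)%E) ->
  (forall n, \sum_(k < n) h k <= B) ->
  exists x, D x /\ forall n, \sum_(k < n) H k x <= B + 1.
Proof.
move=> mD D1 mH H0 Hh hB; apply: contrapT => noex.
have B0 : 0 <= B by have := hB 0%N; rewrite big_ord0.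
have large x : D x -> ((B + 1)%:E <= \sum_(0 <= k <oo) (H k x)%:E)%E.
  move=> Dx; rewrite leNgt; apply/negP => lt; apply: noex; exists x; split=> // n.
  rewrite -lee_fin -sumEFin -(big_mkord xpredT (fun k => (H k x)%:E)).
  by apply: le_trans (ltW lt); apply: nneseries_lim_ge => k _ _; rewrite lee_fin H0.
(* If the series is at least [B + 1] on all of [D], integrating over unit mass and exchanging sum
   and integral bounds [B + 1] by [B]. *)
suff : ((B + 1)%:E <= B%:E)%E by rewrite lee_fin gerDl ler10.
rewrite -[leLHS]mule1 -[X in (_ * X)%E]D1 -integral_cst//.
have mEH n : measurable_fun D (fun x => (H n x)%:E) by exact/measurable_EFinP.
have H0' n x : D x -> (0 <= (H n x)%:E)%E by move=> Dx; rewrite lee_fin H0.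
apply: (@le_trans _ _ (\int[mu]_(x in D) \sum_(0 <= k <oo) (H k x)%:E)%E).
  apply: ge0_le_integral => //.
  - by move=> x _; rewrite lee_fin addr_ge0.
  - by apply: ge0_emeasurable_sum => // *; exact: H0'.
rewrite integral_nneseries//; apply: lime_le.
  by apply: is_cvg_nneseries => n _ _; apply: integral_ge0 => x; exact: H0'.
apply: nearW => n; rewrite (le_trans (y := (\sum_(0 <= k < n) (h k)%:E)%E))//.
  exact: lee_sum.
by rewrite sumEFin lee_fin big_mkord.
Qed.

Lemma bounded_integrable (D : set T) (f : T -> R) (M : R) :
  measurable D -> (mu D < +oo)%E -> measurable_fun D f ->
  (forall x, D x -> `|f x| <= M) -> mu.-integrable D (EFin \o f).
Proof.
move=> mD D1 mf fM; apply: measurable_bounded_integrable => //.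
by exists M; split; rewrite ?num_real// => K MK x Dx /=; rewrite (le_trans (fM _ Dx))// ltW.
Qed.

(** Hoeffding's lemma with a crude constant: 8 is the 2 of [expR_le_quadratic] times the square of
    the bound 2 on [f]. *)
Lemma integral_expR_le (D : set T) (f : T -> R) (l : R) :
  measurable D -> mu D = 1%E -> measurable_fun D f ->
  (forall x, D x -> `|f x| <= 2) -> \int[mu]_(x in D) f x = 0 ->
  (\int[mu]_(x in D) (expR (l * f x))%:E <= (expR (8 * l ^+ 2))%:E)%E.
Proof.
move=> mD D1 mf f2 f0.
have Dy : (mu D < +oo)%E by rewrite D1 ltry.
have lf x : D x -> `|l * f x| <= 2 * `|l|.
  by move=> Dx; rewrite normrM mulrC ler_wpM2r// f2.
have mlf : measurable_fun D (fun x => l * f x) by exact: measurable_funM.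
have ie : mu.-integrable D (EFin \o (fun x => expR (l * f x))).
  apply: (@bounded_integrable _ _ (expR (2 * `|l|))) => //.
    exact: measurableT_comp.
  move=> x Dx; rewrite ger0_norm ?expR_ge0// ler_expR.
  by rewrite (le_trans (ler_norm _))// lf.
have il : mu.-integrable D (EFin \o f) by exact: (@bounded_integrable _ _ 2).
have ilf : mu.-integrable D (EFin \o (fun x => l * f x)).
  exact: (@bounded_integrable _ _ (2 * `|l|)).
have ic : mu.-integrable D (EFin \o (fun=> expR (8 * l ^+ 2))).
  by apply: (@bounded_integrable _ _ `|expR (8 * l ^+ 2)|).
have ib : mu.-integrable D (EFin \o (fun x => l * f x + expR (8 * l ^+ 2))).
  exact: (integrableD mD ilf ic).
rewrite -[leLHS]fineK; last exact: integrable_fin_num.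
rewrite lee_fin (le_trans (le_Rintegral mD ie ib _))//.
  move=> x Dx; rewrite (le_trans (expR_le_quadratic _ _))// lerD2l ler_expR.
  have -> : 2 * (l * f x) ^+ 2 = 2 * l ^+ 2 * `|f x| ^+ 2.
    by rewrite real_normK ?num_real//; ring.
  have -> : 8 * l ^+ 2 = 2 * l ^+ 2 * 2 ^+ 2 by ring.
  by apply: ler_wpM2l; [rewrite mulr_ge0 ?sqr_ge0|rewrite ler_sqr ?nnegrE// f2].
rewrite RintegralD// RintegralZl// f0 mulr0 add0r Rintegral_cst//.
by rewrite [mu D]D1 mulr1.
Qed.

End Derandomization.

Lemma sum_telescope_inv_le1 (R : realFieldType) (n : nat) :
  \sum_(k < n) (k.+1%:R * k.+2%:R)^-1 <= 1 :> R.
Proof.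
suff -> : \sum_(k < n) (k.+1%:R * k.+2%:R)^-1 = 1 - n.+1%:R^-1 :> R.
  by rewrite gerBl invr_ge0.
elim: n => [|n IH]; first by rewrite big_ord0 invr1 subrr.
rewrite big_ord_recr/= IH -(natr1 n.+1).
have : n.+1%:R != 0 :> R by rewrite pnatr_eq0.
have : n.+1%:R + 1 != 0 :> R by rewrite natr1 pnatr_eq0.
by move: (n.+1%:R) => x x1 x0; field; rewrite x0 x1.
Qed.

(** Dependent choice in which each new term may depend on the whole prefix; [x0] makes the choice
    function total on lists where [P] fails. *)
Lemma seq_extension (T : Type) (x0 : T) (P : seq T -> Prop) :
  P [::] -> (forall s, P s -> exists x, P (rcons s x)) ->
  exists y : nat -> T, forall n, P (mkseq y n).
Proof.
move=> P0 Pr.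
have /choice[g Pg] : forall s, exists x, P s -> P (rcons s x).
  by move=> s; have [/Pr[x Px]|nP] := pselect (P s); [exists x|exists x0].
pose st n := iter n (fun s => rcons s (g s)) [::].
exists (fun n => g (st n)) => n.
suff -> : mkseq (fun n => g (st n)) n = st n by elim: n => //= n /Pg.
by elim: n => // n IH; rewrite mkseqS IH.
Qed.

(** * Simultaneous Hoeffding bounds by conditional expectations *)

Section Hoeffding.
Context d (T : measurableType d) (R : realType) (mu : {measure set T -> \bar R}).
Variables (D : nat -> set T) (I : nat -> finType) (c : nat)
  (f : forall L, I L -> nat -> T -> R).
Hypotheses (mD : forall j, measurable (D j)) (D1 : forall j, mu (D j) = 1%E)
  (cardI : forall L, (#|I L| <= L.+2 ^ c)%N)
  (mf : forall L (i : I L) j, measurable_fun (D j) (f _ i j))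
  (f2 : forall L (i : I L) j x, D j x -> `|f _ i j x| <= 2)
  (f0 : forall L (i : I L) j, \int[mu]_(x in D j) f _ i j x = 0).

(** The Chernoff parameter that balances [ln L.+2 / lam] against [lam * N], up to constants. *)
Let lam (L N : nat) : R := Num.sqrt (ln L.+2%:R / N%:R).

(* At level L there are at most (L+2)^c * (L+1) moments, so the initial total
   weight is bounded by the telescoping series of 1/((L+1)(L+2)). *)
Let wt (L : nat) : R := (L.+2%:R ^+ c)^-1 / L.+1%:R * (L.+1%:R * L.+2%:R)^-1.

Let partial L (i : I L) (s : seq T) : R :=
  \sum_(j < size s) f _ i j (nth point s j).

(** The term [8 * lam ^+ 2 * size s] offsets the mean growth of the exponential, so each summand is
    a supermartingale in [s]. The index in ['I_L.+1] is the target length [N], since [lam] must be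
    tuned to it. *)
Let level L (s : seq T) : R := \sum_(p : I L * 'I_L.+1)
  wt L * expR (lam L p.2 * partial _ p.1 s - 8 * lam L p.2 ^+ 2 * (size s)%:R).

(** The budget grows by 1 per point, the slack paid by [le_series_of_le_integral]. Bounding all
    partial sums controls infinitely many levels at once. *)
Let good (s : seq T) : Prop :=
  (forall j, (j < size s)%N -> D j (nth point s j)) /\
  forall n, \sum_(L < n) level L s <= 1 + (size s)%:R.

Let wt_gt0 L : 0 < wt L.
Proof. by rewrite /wt !mulr_gt0 ?invr_gt0 ?mulr_gt0 ?exprn_gt0 ?ltr0n. Qed.

Let good_nil : good [::].
Proof.
split => // n; rewrite /= addr0 (le_trans _ (sum_telescope_inv_le1 R n))//.
apply: ler_sum => L _; rewrite /level /partial /=.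
under eq_bigr do rewrite big_ord0 !mulr0 subrr expR0 mulr1.
rewrite sumr_const card_prod card_ord -[leLHS]mulr_natl natrM.
rewrite /wt mulrA -[leRHS]mul1r ler_wpM2r ?invr_ge0//.
rewrite mulrACA mulfV ?pnatr_eq0// mulr1.
by rewrite ler_pdivrMr ?exprn_gt0 ?ltr0n// mul1r -natrX ler_nat.
Qed.

Let partial_rcons L (i : I L) s x :
  partial _ i (rcons s x) = partial _ i s + f _ i (size s) x.
Proof.
rewrite /partial size_rcons big_ord_recr/=; congr (_ + _).
  by apply: eq_bigr => j _; rewrite nth_rcons ltn_ord.
by rewrite nth_rcons ltnn eqxx.
Qed.

(** Averaged over the next point, each level is at most its current value, so some choice keeps the
    total within the budget. *)
Let good_rcons s : good s -> exists x, good (rcons s x).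
Proof.
move=> [Ds levels].
(* The factor of each summand that is free of the new point; its last divisor cancels against the
   bound of [integral_expR_le]. *)
pose coef L (p : I L * 'I_L.+1) := wt L *
  expR (lam L p.2 * partial _ p.1 s - 8 * lam L p.2 ^+ 2 * (size s)%:R)
  / expR (8 * lam L p.2 ^+ 2).
have coef0 L p : 0 <= coef L p.
  by rewrite /coef !mulr_ge0 ?invr_ge0 ?expR_ge0// ltW.
have levelE L x : level L (rcons s x) =
    \sum_(p : I L * 'I_L.+1) coef L p * expR (lam L p.2 * f _ p.1 (size s) x).
  apply: eq_bigr => p _; rewrite /coef partial_rcons size_rcons -2!(mulrA (wt L)) -expRN -!expRD.
  by congr (_ * expR _); rewrite -natr1; ring.
have mexp L (p : I L * 'I_L.+1) : measurable_fun (D (size s))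
    (fun x => expR (lam L p.2 * f _ p.1 (size s) x)).
  by apply: measurableT_comp => //; exact: measurable_funM.
have [//|//|n|n x _|n||x [Dx Hx]] := @le_series_of_le_integral _ _ _ mu (D (size s))
    (fun L x => level L (rcons s x)) (fun L => level L s) (1 + (size s)%:R).
- under eq_fun do rewrite levelE.
  by apply: measurable_sum => p; exact: measurable_funM.
- by rewrite levelE sumr_ge0// => p _; rewrite mulr_ge0// expR_ge0.
- under eq_integral do rewrite levelE -sumEFin.
  have mEexp (p : I n * 'I_n.+1) : measurable_fun (D (size s))
      (fun x => (expR (lam n p.2 * f _ p.1 (size s) x))%:E) by exact/measurable_EFinP.
  rewrite ge0_integral_sum//.
  + rewrite -sumEFin; apply: lee_sum => p _.
    under eq_integral do rewrite EFinM.
    rewrite ge0_integralZl// ?lee_fin//.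
    apply: (@le_trans _ _ ((coef n p)%:E * (expR (8 * lam n p.2 ^+ 2))%:E)%E).
      apply: lee_wpmul2l; rewrite ?lee_fin//.
      by apply: integral_expR_le => // x; exact: f2.
    by rewrite -EFinM lee_fin /coef divfK ?gt_eqF ?expR_gt0.
  + move=> p; apply/measurable_EFinP; exact: measurable_funM.
  + by move=> p x _; rewrite lee_fin mulr_ge0 ?expR_ge0.
- exact: levels.
- exists x; split => [j|n]; last by rewrite size_rcons -natr1 addrA.
  rewrite size_rcons ltnS nth_rcons leq_eqVlt.
  by case: eqVneq => [->|_ /= js]; rewrite ?ltnn// js; exact: Ds.
Qed.

(** All summands being nonnegative, the single one for [i] and [N] is at most [1 + N]; taking
    logarithms and dividing by [lam] gives the bound. *)
Lemma derandomized_hoeffding : exists y : nat -> T, (forall j, D j (y j)) /\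
  forall L (i : I L) N, (N <= L)%N ->
    \sum_(j < N) f _ i j (y j) <= (c + 12)%:R * Num.sqrt (N%:R * ln L.+2%:R).
Proof.
have [y goody] := seq_extension _ point _ good_nil good_rcons.
exists y; split => [j|L i N NL].
  by have [/(_ j)] := goody j.+1; rewrite size_mkseq nth_mkseq// => /(_ (ltnSn _)).
have [_ /(_ L.+1)] := goody N; rewrite size_mkseq => levels.
have [->|N0] := eqVneq N 0%N; first by rewrite big_ord0 mulr_ge0 ?sqrtr_ge0.
set S := \sum_(j < N) _.
have NLp : (N < L.+1)%N by [].
have level0 K s : 0 <= level K s.
  by rewrite sumr_ge0// => p _; rewrite mulr_ge0 ?expR_ge0// ltW.
have term : wt L * expR (lam L N * S - 8 * lam L N ^+ 2 * N%:R) <= 1 + N%:R.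
  apply: le_trans levels; rewrite big_ord_recr/= -[leLHS]add0r lerD ?sumr_ge0//.
  rewrite /level (bigD1 (i, Ordinal NLp))//= size_mkseq -[leLHS]addr0 lerD//.
    rewrite (_ : partial _ _ _ = S)// /partial size_mkseq.
    by apply: eq_bigr => j _; rewrite nth_mkseq.
  by rewrite sumr_ge0// => p _; rewrite mulr_ge0 ?expR_ge0// ltW.
have NR : 0 < N%:R :> R by rewrite ltr0n lt0n.
set l := ln L.+2%:R.
have l0 : 0 < l by rewrite ln_gt0// ltr1n.
have lam0 : 0 < lam L N by rewrite /lam sqrtr_gt0 divr_gt0.
have lamN : lam L N * N%:R = Num.sqrt (N%:R * l).
  rewrite /lam -/l -[X in _ * X]gtr0_norm// -sqrtr_sqr -sqrtrM ?divr_ge0 ?ltW//.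
  by congr Num.sqrt; field; rewrite gt_eqF.
have lam2 : lam L N ^+ 2 * N%:R = l.
  by rewrite /lam -/l sqr_sqrtr ?divr_ge0 ?ltW// divfK ?gt_eqF.
(* Since [N <= L], the quotient [(1 + N) / wt L] is at most [L.+2 ^ (c + 4)]. Moving [8 * l] to the
   right then gives [c + 12]. *)
have big : lam L N * S - 8 * l <= (c + 4)%:R * l.
  have -> : (c + 4)%:R * l = ln (L.+2%:R ^+ (c + 4)).
    by rewrite mulr_natl lnXn// ltr0n.
  rewrite -ler_expR lnK ?posrE ?exprn_gt0 ?ltr0n//.
  rewrite -(ler_pM2l (wt_gt0 L)) -lam2 mulrA (le_trans term)//.
  rewrite /wt exprD invfM.
  have cancel_weights (e a b : R) : e != 0 -> a != 0 -> b != 0 ->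
      e^-1 / b * (b^-1 * a^-1) * (e * a ^+ 4) = a ^+ 3 / b ^+ 2.
    by move=> e0 a0 b0; field; rewrite e0 a0 b0.
  rewrite cancel_weights ?expf_neq0 ?pnatr_eq0//.
  rewrite ler_pdivlMr ?exprn_gt0 ?ltr0n// [1 + _]addrC natr1 -!natrX -natrM ler_nat.
  by rewrite (expnS L.+2 2); apply: leq_mul; [exact: leqW|rewrite leq_exp2r].
rewrite -(ler_pM2l lam0) mulrCA (le_trans (y := (c + 12)%:R * l))//.
  by move: big; rewrite !natrD; lra.
by rewrite ler_wpM2l// -lamN mulrA -expr2 lam2.
Qed.

End Hoeffding.

(** * One point per unit interval: counting and discrepancy *)

Section UnitIntervals.
Context (R : realType).
Let mu := @lebesgue_measure R.

(** Open on the left, so that all points are positive and their quantiles exceed 1. *)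
Definition unit_itv (j : nat) : set R := `]j%:R, j.+1%:R]%classic.

Definition discrepancy (h : R -> R) (y : nat -> R) (n : nat) : R :=
  \sum_(j < n) (h (y j) - \int[mu]_(u in unit_itv j) h u).

Lemma measurable_unit_itv j : measurable (unit_itv j).
Proof. exact: measurable_itv. Qed.

Lemma lebesgue_unit_itv j : mu (unit_itv j) = 1%E.
Proof.
rewrite /mu /unit_itv lebesgue_measure_itv/= lte_fin ltr_nat ltnSn.
by rewrite -EFinB -natrB ?leqnSn// subSnn.
Qed.

Lemma integrable_itv_oc (h : R -> R) (M a b : R) : measurable_fun [set: R] h ->
  (forall u, `|h u| <= M) ->
  mu.-integrable `]a, b]%classic (EFin \o h).
Proof.
move=> mh hM; apply: (@bounded_integrable _ _ _ mu _ _ M) => //.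
- by rewrite /mu/= lebesgue_measure_itv/=; case: ifP => _; rewrite ltry.
- by apply: measurable_funTS; exact: mh.
Qed.

Lemma normr_integral_le (h : R -> R) (M a b : R) : measurable_fun [set: R] h ->
  a <= b -> 0 <= M -> (forall u, a < u -> u <= b -> `|h u| <= M) ->
  mu.-integrable `]a, b]%classic (EFin \o h) ->
  `|\int[mu]_(u in `]a, b]) h u| <= M * (b - a).
Proof.
move=> mh ab M0 hM ih.
have mab : measurable (`]a, b]%classic : set (measurableTypeR R)) by exact: measurable_itv.
have finab : (mu (`]a, b]%classic) < +oo)%E.
  by rewrite /mu/= lebesgue_measure_itv/=; case: ifP => _; rewrite ltry.
have hM' u : `]a, b]%classic u -> `|h u| <= M.
  by rewrite /= in_itv/= => /andP[au ub]; exact: hM.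
apply: (le_trans (le_normr_Rintegral mab ih)).
apply: (le_trans (le_Rintegral mab _ _ hM')).
- apply: (@bounded_integrable _ _ _ mu _ _ M) => //.
    by apply: measurable_funTS; exact: measurableT_comp.
  by move=> u /hM'; rewrite normr_id.
- by apply: (@bounded_integrable _ _ _ mu _ _ M) => // u _; rewrite ger0_norm.
have muab : fine (mu `]a, b]%classic) <= b - a.
  by rewrite /mu/= lebesgue_measure_itv/=; case: ifP => //= _; rewrite subr_ge0.
by rewrite Rintegral_cst//; apply: ler_wpM2l.
Qed.

Lemma integral_split_nat (h : R -> R) (v : R) (n : nat) : measurable_fun [set: R] h ->
  (forall u, `|h u| <= 1) -> n%:R <= v ->
  \int[mu]_(u in `]0, v]) h u =
  \sum_(j < n) \int[mu]_(u in unit_itv j) h u + \int[mu]_(u in `]n%:R, v]) h u.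
Proof.
move=> mh h1; elim: n => [|n IH] nv; first by rewrite big_ord0 add0r.
have nv' : n%:R <= v by apply: le_trans nv; rewrite ler_nat.
rewrite IH// big_ord_recr/= -addrA; congr (_ + _).
have := @Rintegral_itvB R h (BRight n%:R) (BRight v) n.+1%:R (integrable_itv_oc _ _ _ _ mh h1).
rewrite !bnd_simp ler_nat => /(_ (leqnSn _) nv) <-.
by rewrite addrC subrK.
Qed.

Section Points.
Variable y : nat -> R.
Hypothesis yj : forall j, unit_itv j (y j).

Let yj_lt j : j%:R < y j. Proof. by have := yj j; rewrite /unit_itv/= in_itv/= => /andP[]. Qed.
Let yj_le j : y j <= j.+1%:R. Proof. by have := yj j; rewrite /unit_itv/= in_itv/= => /andP[]. Qed.

Lemma unit_points_ltn i j : (i < j)%N -> y i < y j.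
Proof. by move=> ij; rewrite (le_lt_trans (yj_le i))// (le_lt_trans _ (yj_lt j))// ler_nat. Qed.

(** With [n] the integer part of [v], points of index below [n] are at most [v] and those above [n]
    exceed it; only [y n] is undecided. If it counts, [n < y n <= v] gives the strict bound on
    [M]. *)
Lemma unit_points_set (v : R) : 0 <= v -> exists M, [set j | y j <= v] = `I_M /\
  (Num.trunc v <= M <= (Num.trunc v).+1)%N /\ M%:R < v + 1.
Proof.
move=> v0; have /andP[nv vn] := truncn_itv v0; set n := Num.trunc v in nv vn *.
have small j : (j < n)%N -> y j <= v.
  by move=> jn; rewrite (le_trans (yj_le j))// (le_trans _ nv)// ler_nat.
have large j : (n < j)%N -> ~ (y j <= v).
  by move=> nj; apply/negP; rewrite -ltNge (lt_trans vn)// (le_lt_trans _ (yj_lt j))// ler_nat.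
have [ynv|ynv] := leP (y n) v.
  exists n.+1; split; last by rewrite leqnn leqnSn -natr1 ltrD2r (lt_le_trans (yj_lt n)).
  apply/seteqP; split => j /=; first by rewrite ltnS leqNgt => jv; apply/negP => /large.
  by rewrite ltnS leq_eqVlt => /predU1P[->|/small].
exists n; split; last by rewrite leqnn leqnSn (le_lt_trans nv)// ltrDl.
apply/seteqP; split => j /=; last exact: small.
move=> jv; rewrite ltnNge leq_eqVlt; apply/negP => /predU1P[nj|/large//].
by move: jv; rewrite -nj leNgt ynv.
Qed.

Lemma count_unit_points (v : R) : 0 <= v ->
  `|\sum_(j \in [set j | y j <= v]) (1 : R) - v| <= 1.
Proof.
move=> v0; have [M [-> [/andP[nM _] Mv]]] := unit_points_set _ v0.
rewrite -fsbig_ord sumr_const card_ord ler_norml; apply/andP; split; last first.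
  by rewrite lerBlDl ltW// addrC.
have /andP[_ vn] := truncn_itv v0.
by rewrite lerBrDl lerBlDr ltW// (lt_le_trans vn)// natr1 ler_nat ltnS.
Qed.

(** The 2 pays for the undecided term [h (y n)] and for the integral over the incomplete interval
    []n, v]]. *)
Lemma sum_unit_points (h : R -> R) (v : R) : measurable_fun [set: R] h ->
  (forall u, `|h u| <= 1) -> 0 <= v ->
  `|\sum_(j \in [set j | y j <= v]) h (y j) - \int[mu]_(u in `]0, v]) h u| <=
  `|discrepancy h y (Num.trunc v)| + 2.
Proof.
move=> mh h1 v0; have [M [-> [/andP[nM Mn] _]]] := unit_points_set _ v0.
have /andP[nv vn] := truncn_itv v0; set n := Num.trunc v in nv vn nM Mn *.
rewrite -(fsbig_ord _ _ (fun j => h (y j))) (integral_split_nat _ _ _ mh h1 nv).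
have -> : \sum_(j < M) h (y j) = \sum_(j < n) h (y j) + (n < M)%:R * h (y n).
  move: nM; rewrite leq_eqVlt => /predU1P[<-|nM]; first by rewrite ltnn mul0r addr0.
  have -> : M = n.+1 by apply/eqP; rewrite eqn_leq Mn.
  by rewrite big_ord_recr/= ltnSn mul1r.
rewrite (_ : _ - _ = discrepancy h y n +
    ((n < M)%:R * h (y n) - \int[mu]_(u in `]n%:R, v]) h u)); last first.
  by rewrite /discrepancy sumrB; ring.
rewrite (le_trans (ler_normD _ _))// lerD2l (le_trans (ler_normB _ _))//.
rewrite (_ : 2 = 1 + 1)// lerD//.
  by rewrite normrM normr_nat; case: (n < M)%N; rewrite ?mul1r ?mul0r ?h1.
rewrite (le_trans (normr_integral_le _ 1 _ _ mh nv _ _ _))//.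
  exact: (integrable_itv_oc _ 1).
by rewrite mul1r lerBlDl ltW// natr1.
Qed.

(** Each index contributes [e] at the sample point and [e] in the mean. *)
Lemma discrepancy_perturb (h1 h2 : R -> R) (n : nat) (e : R) :
  measurable_fun [set: R] h1 -> measurable_fun [set: R] h2 ->
  (forall u, `|h1 u| <= 1) -> (forall u, `|h2 u| <= 1) -> 0 <= e ->
  (forall u, 0 < u -> u <= n%:R -> `|h1 u - h2 u| <= e) ->
  `|discrepancy h1 y n| <= `|discrepancy h2 y n| + n%:R * (2 * e).
Proof.
move=> mh1 mh2 h11 h21 e0 he.
have -> : discrepancy h1 y n = discrepancy h2 y n +
    (discrepancy h1 y n - discrepancy h2 y n) by ring.
rewrite (le_trans (ler_normD _ _))// lerD2l -sumrB.
rewrite (le_trans (ler_norm_sum _ _ _))// -[in leRHS](card_ord n) mulr_natl -sumr_const.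
apply: ler_sum => -[j jn] _ /=.
have ih1 := integrable_itv_oc _ 1 j%:R j.+1%:R mh1 h11.
have ih2 := integrable_itv_oc _ 1 j%:R j.+1%:R mh2 h21.
have small u : j%:R < u -> u <= j.+1%:R -> `|h1 u - h2 u| <= e.
  move=> ju uj; apply: he; first exact: le_lt_trans ju.
  by rewrite (le_trans uj)// ler_nat.
set A1 := \int[mu]_(u in unit_itv j) h1 u; set A2 := \int[mu]_(u in unit_itv j) h2 u.
have -> : h1 (y j) - A1 - (h2 (y j) - A2) = h1 (y j) - h2 (y j) - (A1 - A2) by ring.
rewrite (le_trans (ler_normB _ _))// (_ : 2 * e = e + e); last by ring.
rewrite lerD//; first by apply: small.
rewrite -RintegralB//; last exact: measurable_itv.
rewrite (le_trans (normr_integral_le (fun u => h1 u - h2 u) e _ _ _ _ _ _ _))//.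
- exact: measurable_funB.
- by rewrite ler_nat.
- exact: (integrableB _ ih1 ih2).
- by rewrite -natrB// subSnn mulr1.
Qed.

End Points.
End UnitIntervals.

(** * Reduction to a grid of frequencies *)

Lemma exists_sample_points (R : realType) (h : bool -> R -> R -> R) :
  (forall b t, measurable_fun [set: R] (h b t)) ->
  (forall b t u, `|h b t u| <= 1) ->
  exists y : nat -> R, (forall j, unit_itv R j (y j)) /\
    forall b t L n, (n <= L)%N -> `|t| <= L.+1%:R -> exists t',
      `|t - t'| <= L.+1%:R^-1 /\
      `|discrepancy R (h b t') y n| <= 16 * Num.sqrt (n%:R * ln L.+2%:R).
Proof.
move=> mh h1.
pose mu := @lebesgue_measure R.
(* The first boolean is a sign, turning one-sided bounds into absolute values; the second selects
   the function; the ordinal runs over a grid of mesh [1 / L.+1] covering [[- L.+1, L.+1]]. *)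
pose I L : finType := (bool * bool * 'I_(2 * L.+1 ^ 2).+1)%type.
pose grid L (k : nat) : R := k%:R / L.+1%:R - L.+1%:R.
pose mean L (p : I L) j : R := \int[mu]_(u in unit_itv R j) h p.1.2 (grid L p.2) u.
pose f L (p : I L) j (u : measurableTypeR R) : R :=
  (-1) ^+ p.1.1 * (h p.1.2 (grid L p.2) u - mean L p j).
(* With [m = L.+1] this is [4 * (2 * m ^ 2 + 1) <= (m + 1) ^ 4]. Hence [c = 4], and the final
   constant is [c + 12 = 16]. *)
have cardI L : (#|I L| <= L.+2 ^ 4)%N.
  rewrite !card_prod card_bool card_ord -(addn1 L.+1); move: L.+1 (ltn0Sn L) => m m0.
  have -> : ((m + 1) ^ 4 = m ^ 4 + 4 * m ^ 3 + 6 * m ^ 2 + 4 * m + 1)%N by ring.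
  have : (m <= m ^ 2)%N by rewrite leq_pmulr.
  have : (m ^ 2 <= m ^ 3)%N by rewrite leq_pexp2l.
  have : (m ^ 2 <= m ^ 4)%N by rewrite leq_pexp2l.
  by lia.
have mmean L p j : `|mean L p j| <= 1.
  rewrite (le_trans (normr_integral_le _ _ 1 _ _ _ _ _ _ _))//; first by rewrite ler_nat.
    exact: (integrable_itv_oc _ _ 1).
  by rewrite -natrB// subSnn mul1r.
have mf L (p : I L) j : measurable_fun (unit_itv R j : set (measurableTypeR R)) (f L p j).
  apply: measurable_funM => //; apply: measurable_funB => //.
  by apply: measurable_funTS; exact: mh.
have f2 L (p : I L) j u : unit_itv R j u -> `|f L p j u| <= 2.
  move=> _; rewrite /f normrM normrX normrN1 expr1n mul1r.
  by rewrite (le_trans (ler_normB _ _))// (_ : 2 = 1 + 1)// lerD.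
have f0 L (p : I L) j : \int[mu]_(u in unit_itv R j) f L p j u = 0.
  have mD : measurable (unit_itv R j : set (measurableTypeR R)).
    exact: measurable_unit_itv.
  have muy : (mu (unit_itv R j) < +oo)%E by rewrite [X in (X < _)%E]lebesgue_unit_itv ltry.
  have ih : mu.-integrable (unit_itv R j) (EFin \o h p.1.2 (grid L p.2)).
    exact: (integrable_itv_oc _ _ 1).
  have ic : mu.-integrable (unit_itv R j) (EFin \o (fun=> mean L p j)).
    by apply: (@bounded_integrable _ _ _ mu _ _ `|mean L p j|).
  rewrite /f RintegralZl//; last exact: (integrableB mD ih ic).
  rewrite RintegralB// Rintegral_cst//.
  have -> : fine (mu (unit_itv R j)) = 1 by rewrite [mu _]lebesgue_unit_itv.
  by rewrite mulr1 subrr mulr0.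
have [y [yj yb]] := derandomized_hoeffding _ (measurableTypeR R) R mu (unit_itv R) I 4 f
  (measurable_unit_itv R) (lebesgue_unit_itv R) cardI mf f2 f0.
exists y; split => // b t L n nL tL.
have L0 : 0 < L.+1%:R :> R by rewrite ltr0n.
move: tL; rewrite ler_norml => /andP[tL1 tL2].
have s0 : 0 <= (t + L.+1%:R) * L.+1%:R 
  by apply: mulr_ge0; [rewrite -lerBlDr sub0r|exact: ltW].
(* [k] indexes the last grid point not exceeding [t]. *)
have /andP[ks sk] := truncn_itv s0; set k := Num.trunc _ in ks sk.
have kL : (k < (2 * L.+1 ^ 2).+1)%N.
  rewrite ltnS -(ler_nat R); apply: (le_trans ks).
  rewrite natrM natrX expr2 mulrA; apply: ler_wpM2r; first exact: ltW.
  by rewrite mulr_natl mulr2n lerD2r.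
exists (grid L k); split.
  have -> : t - grid L k = ((t + L.+1%:R) * L.+1%:R - k%:R) / L.+1%:R.
    by rewrite /grid; field; rewrite gt_eqF.
  rewrite ger0_norm; last by apply: divr_ge0; rewrite ?subr_ge0.
  rewrite ler_pdivrMr// mulVf ?gt_eqF//.
  by rewrite lerBlDl natr1 ltW.
have bound (s : bool) : (-1) ^+ s * discrepancy R (h b (grid L k)) y n <=
    16 * Num.sqrt (n%:R * ln L.+2%:R).
  have := yb L (s, b, Ordinal kL) n nL.
  by rewrite -mulr_sumr.
rewrite ler_norml; apply/andP; split.
  by rewrite lerNl; have := bound true; rewrite expr1 mulN1r.
by have := bound false; rewrite expr0 mul1r.
Qed.

(** * The oscillating kernels *)

Section Waves.
Context (R : realType).

(** Real part ([true]) and imaginary part ([false]) of [u^(-it)]. *)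
Definition wave (b : bool) (t u : R) : R :=
  if b then cos (t * ln u) else - sin (t * ln u).

Lemma normr_wave_le1 b t u : `|wave b t u| <= 1.
Proof. by case: b; rewrite /wave ?normrN ?cos_max ?sin_max. Qed.

Lemma measurable_wave b t : measurable_fun [set: R] (wave b t).
Proof.
have mtln : measurable_fun [set: R] (fun u => t * ln u : R).
  by apply: measurable_funM => //; exact: measurable_ln.
case: b; rewrite /wave.
  by apply: measurableT_comp mtln; apply: continuous_measurable_fun; exact: continuous_cos.
apply: measurableT_comp => //.
by apply: measurableT_comp mtln; apply: continuous_measurable_fun; exact: continuous_sin.
Qed.

Lemma lipschitz1_of_derive (f df : R -> R) :
  (forall x : R, is_derive x 1 f (df x)) -> (forall x, `|df x| <= 1) ->
  forall a b, `|f a - f b| <= `|a - b|.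
Proof.
move=> fdf df1 a b; wlog ab : a b / b < a => [wlg|].
  have [/wlg//|ab|->] := ltgtP b a; last by rewrite !subrr.
  by rewrite distrC [leRHS]distrC; exact: wlg.
have [|c _ ->] := MVT ab (fun x _ => fdf x).
  by apply: derivable_within_continuous => x _; exact: ex_derive.
by rewrite normrM ler_piMl.
Qed.

Lemma wave_lipschitz b t t' u : 1 <= u ->
  `|wave b t u - wave b t' u| <= `|t - t'| * ln u.
Proof.
move=> u1; have -> : `|t - t'| * ln u = `|t * ln u - t' * ln u|.
  by rewrite -mulrBl normrM (ger0_norm (ln_ge0 u1)).
case: b; rewrite /wave.
  apply: (@lipschitz1_of_derive cos (fun x => - sin x)) => x.
  by rewrite normrN sin_max.
rewrite opprK addrC distrC; apply: (@lipschitz1_of_derive sin cos) => x.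
exact: cos_max.
Qed.

End Waves.

(** * Consequences of the Chebyshev bound *)

Section Estimates.
Context (R : realType).

Lemma sqrtrD_le (a b : R) : 0 <= a -> 0 <= b ->
  Num.sqrt (a + b) <= Num.sqrt a + Num.sqrt b.
Proof.
move=> a0 b0; rewrite -ler_sqr ?nnegrE ?addr_ge0 ?sqrtr_ge0//.
rewrite sqr_sqrtr ?addr_ge0// sqrrD !sqr_sqrtr// addrAC lerDl.
by rewrite mulrn_wge0// mulr_ge0 ?sqrtr_ge0.
Qed.

(** Unlike [ln x], [ln (x + 1)] stays away from 0 on [[1, +oo[]. For [x >= 2], [x + 1 <= x ^+ 2]
    costs a factor 2; on the initial range [F] is at most [F x1] while [x / ln (x + 1) >= 1]. *)
Lemma chebyshev_shift (F : R -> R) : {homo F : x y / x <= y} -> (forall x, 0 <= F x) ->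
  (exists C x0, forall x, x0 <= x -> x > 1 -> F x <= C * (x / ln x)) ->
  exists C, 0 <= C /\ forall x, 1 <= x -> F x <= C * (x / ln (x + 1)).
Proof.
move=> Fhomo F0 [C [x0 FC]]; pose x1 := Num.max x0 2.
exists (2 * `|C| + F x1); split; first by rewrite addr_ge0// mulr_ge0.
move=> x x1'; have lx1 : 0 < ln (x + 1) by rewrite ln_gt0// ltrDr (lt_le_trans ltr01).
have x0' : 0 < x by exact: lt_le_trans x1'.
have xl : 1 <= x / ln (x + 1).
  by rewrite ler_pdivlMr// mul1r addrC le_ln1Dx// (lt_trans _ x0')// ltrN10.
have xl0 := le_trans ler01 xl.
rewrite mulrDl; have [x1x|xx1] := leP x1 x; last first.
  rewrite -[leLHS]add0r; apply: lerD; first by apply: mulr_ge0 => //; rewrite mulr_ge0.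
  by rewrite (le_trans (Fhomo _ _ (ltW xx1)))// ler_peMr.
have x2 : 2 <= x by rewrite (le_trans _ x1x)// le_max lexx orbT.
have x0x : x0 <= x by rewrite (le_trans _ x1x)// le_max lexx.
have x1lt : 1 < x by rewrite (lt_le_trans _ x2)// ltr1n.
have lx : 0 < ln x by rewrite ln_gt0.
rewrite -[leLHS]addr0; apply: lerD; last by rewrite mulr_ge0.
rewrite (le_trans (FC x x0x x1lt))//.
rewrite (le_trans (y := `|C| * (x / ln x)))//.
  by rewrite ler_wpM2r ?ler_norm// divr_ge0 ?ltW.
rewrite [2 * `|C|]mulrC -mulrA; apply: ler_wpM2l => //.
rewrite mulrCA; apply: ler_wpM2l; first exact: ltW.
rewrite ler_pdivlMr// mulrC ler_pdivrMr// mulr_natl -lnXn//.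
rewrite ler_ln ?posrE ?exprn_gt0 ?addr_gt0// expr2.
by nra.
Qed.

(** As [n] is O(x), [ln L.+2] is O(ln (x + 1) + ln (t + 1)); multiplying by
    [n <= C * (x / ln (x + 1))] cancels the first logarithm. *)
Lemma count_log_bound (C : R) : 0 <= C -> exists K, 0 <= K /\
  forall (x t : R) (n L : nat), 1 <= x -> 0 <= t ->
    n%:R <= C * (x / ln (x + 1)) -> L.+2%:R <= x + t + 4 + n%:R ->
    n%:R * ln L.+2%:R <= K * (x + x * ln (t + 1) / ln (x + 1)).
Proof.
move=> C0; pose l2 : R := ln 2.
have l20 : 0 < l2 by rewrite ln_gt0// ltr1n.
have Cl0 : 0 <= C / l2 by rewrite divr_ge0// ltW.
(* Chosen so that [x + t + 4 + n <= A * ((x + 1) * (t + 1))], using [n <= C / l2 * x]. *)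
pose A := 5 + C / l2.
have A1 : 1 <= A by rewrite /A; lra.
have lA := ln_ge0 A1.
exists (C * (ln A / l2 + 1)); split.
  by rewrite mulr_ge0// addr_ge0// divr_ge0// ltW.
move=> x t n L x1 t0 nC Lx.
have l2l : l2 <= ln (x + 1).
  by rewrite ler_ln ?posrE ?addr_gt0// ?(lt_le_trans _ x1)//; lra.
set l := ln (x + 1) in nC l2l *; set m := ln (t + 1).
have l0 : 0 < l by exact: lt_le_trans l2l.
have m0 : 0 <= m by rewrite ln_ge0// lerDr.
have x0 : 0 <= x by rewrite (le_trans _ x1).
have nx : n%:R <= C / l2 * x.
  rewrite (le_trans nC)// mulrA mulrAC ler_wpM2r// ler_wpM2l//.
  by rewrite lef_pV2 ?posrE.
have LA : L.+2%:R <= A * ((x + 1) * (t + 1)).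
  rewrite (le_trans Lx)// /A; move: nx Cl0; set c := C / l2 => nx c0.
  have xt : 0 <= x * t by rewrite mulr_ge0.
  have cxt : 0 <= c * (x * t + t + 1) by rewrite mulr_ge0//; lra.
  by move: cxt; rewrite !mulrDr !mulrDl; lra.
have lnL : ln L.+2%:R <= (ln A / l2 + 1) * (l + m).
  rewrite (le_trans (y := ln (A * ((x + 1) * (t + 1)))))//.
    by rewrite ler_ln ?posrE ?ltr0n// (lt_le_trans _ LA)// ltr0n.
  rewrite !lnM ?posrE ?mulr_gt0//; try lra.
  rewrite -/l -/m mulrDl mul1r lerD2r mulrAC ler_pdivlMr//.
  by rewrite ler_wpM2l// (le_trans l2l)// lerDl.
have lnL0 : 0 <= ln L.+2%:R :> R by rewrite ln_ge0// ler1n.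
rewrite (le_trans (ler_pM _ _ nC lnL))//.
rewrite le_eqVlt; apply/orP; left; apply/eqP.
by field; rewrite !gt_eqF.
Qed.

End Estimates.

(** * Error of the exponential sums and construction of the primes *)

Section Sampling.
Context (R : realType) (F : cumulative R R).
Hypotheses (F0 : forall x : R, x <= 1 -> F x = 0)
  (Finfty : F x @[x --> +oo] --> +oo)
  (Fcheb : exists C : R, exists x0 : R, forall x : R, x0 <= x -> x > 1 ->
             F x <= C * (x / ln x)).

Lemma quantile_points_set (y : nat -> R) (x : R) : 1 <= x ->
  [set j | (quantile F \o y) j <= x] = [set j | y j <= F x].
Proof.
by move=> x1; apply/seteqP; split => j /=; rewrite quantile_le.
Qed.

Lemma wave_sum_error : exists (y : nat -> R) (K : R), (forall j, unit_itv R j (y j)) /\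
  forall b t x, 1 <= x ->
    `|\sum_(j \in [set j | (quantile F \o y) j <= x]) wave R b t ((quantile F \o y) j)
      - stieltjes F (wave R b t) x| <=
    K * (Num.sqrt x + Num.sqrt (x * ln (`|t| + 1) / ln (x + 1))).
Proof.
have [C [C0 FC]] := chebyshev_shift R F (cumulative_homo R F) (cumulative_ge0 R F F0) Fcheb.
have [K [K0 Klog]] := count_log_bound R C C0.
have mh b t : measurable_fun [set: R] (wave R b t \o quantile F).
  apply: measurableT_comp; first exact: measurable_wave.
  exact: measurable_quantile.
have h1 b t u : `|(wave R b t \o quantile F) u| <= 1 by exact: normr_wave_le1.
have [y [yj ydisc]] := exists_sample_points R _ mh h1.
(* The terms come from the discrepancy at a grid frequency, the move from [t] to that frequency, and
   the incomplete last interval. *)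
exists y, (16 * Num.sqrt K + 2 * C + 2); split => // b t x x1.
rewrite quantile_points_set// (stieltjes_quantile R F F0 Finfty)//; first last.
- exact: normr_wave_le1.
- exact: measurable_wave.
have Fx0 := cumulative_ge0 R F F0 x.
apply: (le_trans (sum_unit_points R y yj _ _ (mh b t) (h1 b t) Fx0)).
have /andP[nF Fn] := truncn_itv Fx0; set n := Num.trunc (F x) in nF Fn *.
(* [L] must dominate [n] for the Hoeffding bound, [t] for the grid, and [x] so that the mesh absorbs
   the perturbation. *)
pose L := (Num.trunc x + Num.trunc `|t| + n)%N.
have x0 : 0 <= x by rewrite (le_trans _ x1).
have /andP[xt1 xt2] := truncn_itv x0.
have /andP[tt1 tt2] := truncn_itv (normr_ge0 t).
have nL : (n <= L)%N by rewrite leq_addl.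
have tL : `|t| <= L.+1%:R.
  by rewrite (le_trans (ltW tt2))// ler_nat ltnS /L addnAC leq_addl.
have xL : x <= L.+1%:R.
  by rewrite (le_trans (ltW xt2))// ler_nat ltnS /L -addnA leq_addr.
have LL : L.+2%:R <= x + `|t| + 4 + n%:R.
  by rewrite -addn2 /L !natrD; lra.
have nC : n%:R <= C * (x / ln (x + 1)) by exact: le_trans (FC _ x1).
have {Klog}nlog := Klog x `|t| n L x1 (normr_ge0 t) nC LL.
have [t' [tt' disct']] := ydisc b t L n nL tL.
have L0 : 0 < L.+1%:R :> R by rewrite ltr0n.
have lx0 : 0 <= ln x by exact: ln_ge0.
have l10 : 0 < ln (x + 1) by rewrite ln_gt0// ltrDr (lt_le_trans ltr01).
pose e := ln x / L.+1%:R.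
have e0 : 0 <= e by rewrite divr_ge0// ltW.
have perturb u : 0 < u -> u <= n%:R ->
    `|(wave R b t \o quantile F) u - (wave R b t' \o quantile F) u| <= e.
  move=> u0 un; have q1 := quantile_ge1 R F Finfty u.
  have qx : quantile F u <= x by rewrite quantile_le// (le_trans un).
  rewrite (le_trans (wave_lipschitz _ _ _ _ _ q1))// mulrC ler_pM ?ln_ge0//.
  by rewrite ler_ln ?posrE ?(lt_le_trans ltr01).
have := discrepancy_perturb R y yj _ _ n e (mh b t) (mh b t') (h1 b t) (h1 b t') e0 perturb.
(* By Chebyshev [n * ln x <= C * x], and [x <= L.+1]. *)
have ne : n%:R * (2 * e) <= 2 * C.
  rewrite mulrCA ler_wpM2l// /e mulrA ler_pdivrMr//.
  apply: (@le_trans _ _ (C * x)); last by rewrite ler_wpM2l.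
  apply: (@le_trans _ _ (C * (x / ln (x + 1)) * ln (x + 1))).
    apply: ler_pM => //; rewrite ler_ln ?posrE ?addr_gt0 ?(lt_le_trans ltr01)//.
    by rewrite lerDl.
  by rewrite -mulrA divfK// gt_eqF.
set B := Num.sqrt x + _.
(* Lets [B] absorb the bounded errors. *)
have B1 : 1 <= B.
  by rewrite -[leLHS]addr0 lerD ?sqrtr_ge0// -[leLHS]sqrtr1 ler_wsqrtr.
have nB : Num.sqrt (n%:R * ln L.+2%:R) <= Num.sqrt K * B.
  rewrite (le_trans (ler_wsqrtr nlog))// sqrtrM// ler_wpM2l ?sqrtr_ge0// sqrtrD_le//.
  by rewrite divr_ge0 ?mulr_ge0 ?ln_ge0 ?lerDr// ltW.
have CB : 2 * C + 2 <= (2 * C + 2) * B by rewrite ler_peMr//; lra.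
by move: disct' nB CB ne; lra.
Qed.

(** The modulus is at most the sum of the absolute values of its real and imaginary parts. *)
Lemma osc_bound_of_waves (p : nat -> R) (K : R) :
  (forall b t x, 1 <= x ->
    `|\sum_(j \in [set j | p j <= x]) wave R b t (p j) - stieltjes F (wave R b t) x| <=
    K * (Num.sqrt x + Num.sqrt (x * ln (`|t| + 1) / ln (x + 1)))) ->
  osc_bound F p.
Proof.
move=> pK; exists (K + K) => t x x1; rewrite mulrDl.
apply: le_trans (lerD (pK true t x x1) (pK false t x x1)).
rewrite /osc_err (le_trans (sqrtrD_le _ _ _ _ _))// ?sqr_ge0//.
by rewrite !sqrtr_sqr.
Qed.

Lemma exists_sampled_primes : exists y : nat -> R, (forall j, unit_itv R j (y j)) /\
  [/\ gen_primes (quantile F \o y),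
      forall x, 1 <= x -> `|gpi (quantile F \o y) x - F x| <= 1 &
      osc_bound F (quantile F \o y)].
Proof.
have [y [K [yj yK]]] := wave_sum_error; exists y; split => //; split.
- have yj_gt j : j%:R < y j by have := yj j; rewrite /unit_itv/= in_itv/= => /andP[].
  split; first by apply: quantile_gt1 => //; exact: (yj_gt 0%N).
  split; last by apply: quantile_cvgy => // n; rewrite ltW.
  move=> i j; rewrite leq_eqVlt => /predU1P[->//|ij].
  by apply: quantile_homo => //; rewrite ltW// unit_points_ltn.
- move=> x x1; rewrite /gpi quantile_points_set//.
  by apply: count_unit_points => //; exact: cumulative_ge0.
- exact: osc_bound_of_waves yK.
Qed.

End Sampling.

Theorem theorem1p2 (R : realType) (F : cumulative R R)
  (F0 : forall x : R, x <= 1 -> F x = 0)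
  (Finfty : F x @[x --> +oo] --> +oo)
  (Fcheb : exists C : R, exists x0 : R, forall x : R, x0 <= x -> x > 1 ->
             F x <= C * (x / ln x)) :
  (exists p : nat -> R, gen_primes p /\
     (forall x : R, 1 <= x -> `|gpi p x - F x| <= 2) /\ osc_bound F p) /\
  ({in `[1, +oo[, continuous F} ->
   exists p : nat -> R, gen_primes p /\
     (forall i j : nat, (i < j)%N -> p i < p j) /\
     (forall x : R, 1 <= x -> `|gpi p x - F x| <= 1) /\ osc_bound F p).
Proof.
have [y [yj [py piy oscy]]] := exists_sampled_primes R F F0 Finfty Fcheb.
split.
  exists (quantile F \o y); split => //; split => // x x1.
  by rewrite (le_trans (piy x x1))// ler1n.
(* The same sequence serves: continuity makes the quantile strictly increasing on positive reals,
   and [y] is strictly increasing. *)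
move=> Fc; exists (quantile F \o y); split => //; split; last by split.
move=> i j ij /=; apply: quantile_strict => //; last exact: unit_points_ltn yj _ _ ij.
by have := yj i; rewrite /unit_itv/= in_itv/= => /andP[/(le_lt_trans (ler0n _ _))].
Qed.
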